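(* Every sharp domain is pseudo-Dedekind. In particular, a sharp domain is a completely integrally closed generalized GCD domain.
   Context: All rings are integral domains (commutative, unitary, without zero-divisors). A domain $D$ is called a sharp domain if whenever $I \supseteq AB$ with $I, A, B$ nonzero ideals of $D$, there exist ideals $A' \supseteq A$ and $B' \supseteq B$ of $D$ such that $I = A'B'$. Let $K$ be the quotient field of $D$. For a nonzero fractional ideal $I$ of $D$, put $I^{-1} = \{x \in K \mid xI \subseteq D\}$; the $v$-closure of $I$ is $I_v = (I^{-1})^{-1}$. A domain $D$ is pseudo-Dedekind if the $v$-closure of each nonzero ideal of $D$ is invertible. A domain $D$ is a generalized GCD domain (GGCD domain) if the $v$-closure of each nonzero finitely generated ideal of $D$ is invertible. $D$ is completely integrally closed if every $x \in K$ for which there is a nonzero $d \in D$ with $dx^n \in D$ for all $n \geq 1$ belongs to $D$. *)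

(* Defs.v *)
From mathcomp Require Import all_boot all_algebra.
From mathcomp Require Import boolp classical_sets.

Set Implicit Arguments.
Unset Strict Implicit.
Unset Printing Implicit Defensive.

Import GRing.Theory.
Local Open Scope classical_set_scope.
Local Open Scope ring_scope.

(* Ideals are arbitrary subsets [set D]: the ideals of MathComp's
   ring_quotient (idealr) are proper by definition, whereas the unit ideal
   must be allowed as a factor here. *)
Definition is_ideal (D : idomainType) (I : set D) : Prop :=
  [/\ I 0,
      forall x y, I x -> I y -> I (x + y)
    & forall a x, I x -> I (a * x)].

Definition nonzero_set (R : nzRingType) (S : set R) : Prop :=
  exists2 x, S x & x != 0.

Definition nonzero_ideal (D : idomainType) (I : set D) : Prop :=
  is_ideal I /\ nonzero_set I.

(* The finite sums of products a * b with a in A and b in B; used both for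
   ideals (R = D) and for fractional ideals (R = {fraction D}). *)
Definition ideal_mul (R : nzRingType) (A B : set R) : set R :=
  [set x | exists2 s : seq (R * R),
     forall p, p \in s -> A p.1 /\ B p.2 & x = \sum_(p <- s) p.1 * p.2].

Definition sharp_domain (D : idomainType) : Prop :=
  forall I A B : set D,
    nonzero_ideal I -> nonzero_ideal A -> nonzero_ideal B ->
    ideal_mul A B `<=` I ->
    exists A' B' : set D,
      [/\ is_ideal A', is_ideal B', A `<=` A', B `<=` B' & I = ideal_mul A' B'].

Definition fg_ideal (D : idomainType) (I : set D) : Prop :=
  exists s : seq D,
    I = [set x | exists c : 'I_(size s) -> D, x = \sum_i c i * s`_i].

Definition embed (D : idomainType) : D -> {fraction D} := @FracField.tofrac D.

Definition fractional_ideal (D : idomainType) (J : set {fraction D}) : Prop :=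
  [/\ J 0,
      forall x y, J x -> J y -> J (x + y),
      forall a x, J x -> J (embed a * x)
    & exists2 d : D, d != 0 & forall x, J x -> range (@embed D) (embed d * x)].

Definition frac_inv (D : idomainType) (J : set {fraction D}) :
    set {fraction D} :=
  [set x | forall y, J y -> range (@embed D) (x * y)].

Definition v_closure (D : idomainType) (J : set {fraction D}) :
    set {fraction D} :=
  frac_inv (frac_inv J).

Definition invertible (D : idomainType) (J : set {fraction D}) : Prop :=
  fractional_ideal J /\
  exists2 J' : set {fraction D},
    fractional_ideal J' & ideal_mul J J' = range (@embed D).

Definition pseudo_Dedekind (D : idomainType) : Prop :=
  forall I : set D, nonzero_ideal I -> invertible (v_closure (@embed D @` I)).

Definition GGCD_domain (D : idomainType) : Prop :=
  forall I : set D,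
    nonzero_ideal I -> fg_ideal I -> invertible (v_closure (@embed D @` I)).

Definition completely_integrally_closed (D : idomainType) : Prop :=
  forall x : {fraction D},
    (exists2 d : D, d != 0 &
       forall n : nat, (1 <= n)%N -> range (@embed D) (embed d * x ^+ n)) ->
    range (@embed D) x.

(* Main.v *)
Require Import Defs.
From HB Require Import structures.
From mathcomp Require Import all_boot all_algebra.
From mathcomp Require Import boolp classical_sets.

(** Everything rests on one application of sharpness.  Let [A] be a nonzero
    ideal, [0 <> a] in [A], and [B := (aD : A) = a A^-1].  Since [A B] lies in
    [aD], sharpness gives [aD = A' B'] with [A] inside [A'] and [B] inside
    [B'].  Now [A' B'] inside [aD] forces [B'] to lie in [(aD : A) = a A^-1]
    and [A'] to lie in [(aD : B) = A_v].  Dividing [aD = A' B'] by [a] gives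
    [D] inside [A_v A^-1]; the other inclusion is the definition of [A_v].
    So [A_v] is invertible, with inverse [A^-1].

    Complete integral closure holds in any pseudo-Dedekind domain: if
    [d x^n] is in [D] for all [n], the ideal [I] of all [y] in [D] with every
    [y x^n] in [D] is nonzero and stable under [x], hence so is [I_v], and
    multiplying [x I_v <= I_v] by the inverse of [I_v] yields [x] in [D].  The
    GGCD property is the pseudo-Dedekind one restricted to finitely generated
    ideals. *)

Set Implicit Arguments.
Unset Strict Implicit.
Unset Printing Implicit Defensive.

Import GRing.Theory.
Local Open Scope classical_set_scope.
Local Open Scope ring_scope.

(** * Fractional ideals in the quotient field *)

Section FractionalIdeals.
Variable D : idomainType.
Implicit Types (J : set {fraction D}) (A : set D).

HB.instance Definition _ := GRing.RMorphism.copy (@embed D) (@FracField.tofrac D).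

Lemma embed_eq0 (x : D) : (embed x == 0) = (x == 0).
Proof. exact: tofrac_eq0. Qed.

Lemma embed_inj : injective (@embed D).
Proof. by move=> x y /eqP; rewrite tofrac_eq => /eqP. Qed.

Lemma range_embed0 : range (@embed D) 0.
Proof. by exists 0; rewrite ?rmorph0. Qed.

Lemma range_embedD x y :
  range (@embed D) x -> range (@embed D) y -> range (@embed D) (x + y).
Proof. by move=> [a _ <-] [b _ <-]; exists (a + b); rewrite ?rmorphD. Qed.

Lemma range_embedM x y :
  range (@embed D) x -> range (@embed D) y -> range (@embed D) (x * y).
Proof. by move=> [a _ <-] [b _ <-]; exists (a * b); rewrite ?rmorphM. Qed.

Lemma range_embed_sum (T : eqType) (s : seq T) (F : T -> {fraction D}) :
  (forall p, p \in s -> range (@embed D) (F p)) ->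
  range (@embed D) (\sum_(p <- s) F p).
Proof.
move=> sF; rewrite big_seq; apply: (big_ind (range (@embed D))) => //.
exact: range_embedD.
Qed.

(** The element [embed d] serves as common denominator of [J^-1]. *)
Lemma frac_inv_fractional J (d : D) :
  d != 0 -> J (embed d) -> fractional_ideal (frac_inv J).
Proof.
move=> d0 Jd; split.
- by move=> y _; rewrite mul0r; exact: range_embed0.
- by move=> x y Jx Jy z Jz; rewrite mulrDl; apply: range_embedD; auto.
- move=> a x Jx z Jz; rewrite -mulrA; apply: range_embedM; last exact: Jx.
  by exists a.
- by exists d => // x Jx; rewrite mulrC; exact: Jx.
Qed.

Lemma frac_inv_integral1 A : frac_inv (@embed D @` A) (embed 1).
Proof. by move=> _ [a _ <-]; exists a; rewrite // rmorph1 mul1r. Qed.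

(** Both [A^-1] and [A_v] are inverses of fractional sets that meet [D] away
    from 0: the former by hypothesis, the latter because [1] is in [A^-1]. *)
Lemma v_closure_invertible A :
  nonzero_set A ->
  range (@embed D) `<=`
    ideal_mul (v_closure (@embed D @` A)) (frac_inv (@embed D @` A)) ->
  invertible (v_closure (@embed D @` A)).
Proof.
move=> [a Aa a0] sub; split.
  exact: (frac_inv_fractional (oner_neq0 D) (@frac_inv_integral1 A)).
exists (frac_inv (@embed D @` A)).
  by apply: (frac_inv_fractional a0); exists a.
apply/seteqP; split => // _ [s sP ->]; apply: range_embed_sum => p /sP[vp ip].
exact: vp.
Qed.

Lemma frac_inv_stable J x :
  (forall y, J y -> J (x * y)) ->
  forall z, frac_inv J z -> frac_inv J (x * z).
Proof.
by move=> xJ z Jz y Jy; rewrite mulrAC mulrC; apply: Jz; exact: xJ.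
Qed.

(** Multiply [x J <= J] by the inverse of [J]. *)
Lemma invertible_stable J x :
  invertible J -> (forall y, J y -> J (x * y)) -> range (@embed D) x.
Proof.
move=> [_ [J' _ JJ']] xJ.
have [s sP s1] : ideal_mul J J' 1 by rewrite JJ'; exists 1; rewrite ?rmorph1.
rewrite -(mulr1 x) s1 mulr_sumr; apply: range_embed_sum => p /sP[Jp J'p].
rewrite -JJ'; exists [:: (x * p.1, p.2)]; last by rewrite big_seq1 mulrA.
by move=> q; rewrite inE => /eqP-> /=; split=> //; exact: xJ.
Qed.

End FractionalIdeals.

(** * Consequences of sharpness *)

Section Sharp.
Variable D : idomainType.
Implicit Types A B : set D.

Definition principal_ideal (a : D) : set D := [set a * r | r in setT].

Definition colon_principal (a : D) A : set D :=
  [set b | forall c, A c -> principal_ideal a (b * c)].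

Lemma principal_is_ideal a : is_ideal (principal_ideal a).
Proof.
split; first by exists 0; rewrite ?mulr0.
  by move=> _ _ [r _ <-] [t _ <-]; exists (r + t); rewrite ?mulrDr.
by move=> b _ [r _ <-]; exists (b * r); rewrite // mulrCA.
Qed.

Lemma principal_self a : principal_ideal a a.
Proof. by exists 1; rewrite ?mulr1. Qed.

Lemma colon_principal_is_ideal a A : is_ideal (colon_principal a A).
Proof.
have [p0 pD pM] := principal_is_ideal a; split.
- by move=> c _; rewrite mul0r.
- by move=> x y Ix Iy c Ac; rewrite mulrDl; apply: pD; auto.
- by move=> b x Ix c Ac; rewrite -mulrA; apply: pM; exact: Ix.
Qed.

Lemma colon_principal_self a A : colon_principal a A a.
Proof. by move=> c _; exists c. Qed.

Lemma ideal_mul_in (R : nzRingType) (S T : set R) x y :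
  S x -> T y -> ideal_mul S T (x * y).
Proof.
move=> Sx Ty; exists [:: (x, y)]; last by rewrite big_seq1.
by move=> p; rewrite inE => /eqP->.
Qed.

Lemma ideal_mul_sub A B I :
  is_ideal I -> (forall a b, A a -> B b -> I (a * b)) -> ideal_mul A B `<=` I.
Proof.
move=> [I0 ID _] AB _ [s sP ->]; rewrite big_seq; apply: (big_ind I) => //.
by move=> p /sP[Ap Bp]; exact: AB.
Qed.

Lemma principal_divE (a c : D) (a0 : a != 0) :
  principal_ideal a c <-> range (@embed D) (embed c / embed a).
Proof.
have ea0 : embed a != 0 by rewrite embed_eq0.
split=> [[r _ <-]|[r _ rE]].
  by exists r; rewrite // rmorphM /= mulrAC divff ?mul1r.
exists r => //; apply: embed_inj.
by rewrite rmorphM /= rE mulrC divfK.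
Qed.

(** The identity [(aD : A) = a A^-1].  The hypothesis [A a] puts [a A^-1]
    inside [D], so that its elements are images of elements of [D]. *)
Lemma colon_principalE (a : D) A (a0 : a != 0) (Aa : A a) y :
  frac_inv (@embed D @` A) y <->
  exists2 b, colon_principal a A b & y = embed b / embed a.
Proof.
have ea0 : embed a != 0 by rewrite embed_eq0.
split=> [Ay|[b bP ->] _ [c Ac <-]].
  have [|b _ bE] := Ay (embed a); first by exists a.
  exists b => [c Ac|]; last by rewrite bE mulfK.
  apply/(principal_divE _ a0); rewrite rmorphM /= bE mulrAC mulfK //.
  by apply: Ay; exists c.
by rewrite mulrAC -rmorphM; apply/principal_divE => //; exact: bP.
Qed.

(** Sharpness is applied to [aD] and the product of [A] by [(aD : A)]; the
    factors it yields are [A'] inside [A_v] and [B'] inside [a A^-1]. *)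
Lemma sharp_pseudo_Dedekind : sharp_domain D -> pseudo_Dedekind D.
Proof.
move=> hD A [Aid Anz]; apply: v_closure_invertible => //.
have [a Aa a0] := Anz; have ea0 : embed a != 0 by rewrite embed_eq0.
have [||||A' [B' [_ _ AA' BB' aE]]] :=
    hD (principal_ideal a) A (colon_principal a A).
- by split; [exact: principal_is_ideal | exists a; first exact: principal_self].
- by split.
- split; first exact: colon_principal_is_ideal.
  by exists a; first exact: colon_principal_self.
- apply: ideal_mul_sub; first exact: principal_is_ideal.
  by move=> c b Ac Bb; rewrite mulrC; exact: Bb.
have A'v c : A' c -> v_closure (@embed D @` A) (embed c).
  move=> A'c y /(colon_principalE a0 Aa)[b Bb ->].
  rewrite mulrA -rmorphM; apply/principal_divE => //; rewrite aE.
  by apply: ideal_mul_in => //; exact: BB'.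
have B'inv b : B' b -> frac_inv (@embed D @` A) (embed b / embed a).
  move=> B'b; apply/(colon_principalE a0 Aa); exists b => // c Ac.
  by rewrite mulrC aE; apply: ideal_mul_in => //; exact: AA'.
have [s sP sE] : ideal_mul A' B' a by rewrite -aE; exact: principal_self.
have [_ _ vM _] := frac_inv_fractional (oner_neq0 D) (@frac_inv_integral1 D A).
(* From a = \sum a'_i b'_i follows r = \sum (r a'_i) (b'_i / a). *)
move=> _ [r _ <-].
exists [seq (embed r * embed p.1, embed p.2 / embed a) | p <- s].
  move=> _ /mapP[p /sP[A'p B'p] ->] /=; split; last exact: B'inv.
  by apply: vM; exact: A'v.
rewrite big_map -[LHS](mulfK ea0) -rmorphM {1}sE mulr_sumr rmorph_sum mulr_suml.
by apply: eq_bigr => p _; rewrite /= !rmorphM /= !mulrA.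
Qed.

(** The elements of [D] multiplying every power of [x] into [D] form an ideal
    stable under [x], nonzero exactly when [x] is almost integral. *)
Lemma pseudo_Dedekind_completely_integrally_closed :
  pseudo_Dedekind D -> completely_integrally_closed D.
Proof.
move=> pD x [d d0 dx].
pose I : set D := [set y | forall n, range (@embed D) (embed y * x ^+ n)].
have Iid : is_ideal I.
  split.
  - by move=> n; rewrite rmorph0 mul0r; exact: range_embed0.
  - by move=> y z Iy Iz n; rewrite rmorphD mulrDl; exact: range_embedD.
  - move=> a y Iy n; rewrite rmorphM -mulrA.
    by apply: range_embedM; [exists a | exact: Iy].
have Id : I d by case=> [|n]; [exists d; rewrite ?mulr1 | exact: dx].
apply: (invertible_stable (pD I _)); first by split=> //; exists d.
do 2!apply: frac_inv_stable; move=> _ [y Iy <-].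
have [z _ zE] := Iy 1%N; exists z; last by rewrite zE expr1 mulrC.
by move=> n; rewrite zE -mulrA -exprD; exact: Iy.
Qed.

End Sharp.

Theorem proposition4 (D : idomainType) (hD : sharp_domain D) :
  pseudo_Dedekind D /\ (completely_integrally_closed D /\ GGCD_domain D).
Proof.
have pD := sharp_pseudo_Dedekind hD.
split=> //; split; first exact: pseudo_Dedekind_completely_integrally_closed.
by move=> I nzI _; exact: pD.
Qed.
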